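(* There is a deterministic semi-online algorithm for preemptive machine minimization that is $\mathcal{O}(\log n)$-competitive: on every instance of $n$ jobs it produces a feasible schedule using $\mathcal{O}(\log n)\cdot m$ machines, where $m$ is the optimal number of machines.
   Context: Machine minimization with deadlines: each job $j$ of a finite instance has integer release date $r_j$, processing time $p_j$ and deadline $d_j$. A feasible preemptive schedule on a given number of identical machines processes each job for $p_j$ units within $[r_j,d_j]$, each machine processing at most one job at a time, no job on two machines at once; preemption and migration allowed. $m$ is the minimum number of machines admitting a feasible schedule. Semi-online: each job becomes known only at its release date, the algorithm makes its decisions over time, and the value $m$ is given to the algorithm in advance. *)

(* Defs.v *)
From HB Require Import structures.
From mathcomp Require Import all_boot all_order all_algebra.
From mathcomp Require Import all_classical all_reals all_analysis.
Import Order.TTheory GRing.Theory Num.Theory.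
Import numFieldNormedType.Exports.

Set Implicit Arguments.
Unset Strict Implicit.
Unset Printing Implicit Defensive.

Local Open Scope classical_set_scope.
Local Open Scope ring_scope.

(* Names only identify jobs: two jobs may share all three parameters. *)
Record job := Job {
  name : nat;
  release : int;
  proc : nat;
  deadline : int
}.

Definition job_code (j : job) : nat * int * nat * int :=
  (name j, release j, proc j, deadline j).
Definition job_decode (c : nat * int * nat * int) : job :=
  let: (i, r, p, d) := c in Job i r p d.
Lemma job_codeK : cancel job_code job_decode.
Proof. by case. Qed.
HB.instance Definition _ := Equality.copy job (can_type job_codeK).

Definition distinct_names (I : seq job) : bool := uniq (map name I).

(* [S t k = Some i]: at time [t], machine [k] processes the job named [i];
   [None] means that it is idle.  Hence a machine never processes two jobs
   at once. *)
Definition schedule (R : realType) := R -> nat -> option nat.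

Section Scheduling.
Variable R : realType.

Definition processing_times (S : schedule R) (i : nat) : set R :=
  [set t | exists k, S t k = Some i].

(* Time is continuous and preemption may happen at any real time; the amount
   of processing is the Lebesgue measure of the set of times at which the job
   is processed. *)
Definition feasible (K : nat) (I : seq job) (S : schedule R) : Prop :=
  [/\ forall t k i, S t k = Some i -> (k < K)%N /\
        exists j, [/\ j \in I, name j = i
                   & (release j)%:~R <= t <= (deadline j)%:~R],
      forall t k l i, S t k = Some i -> S t l = Some i -> k = l,
      forall k i, measurable [set t | S t k = Some i]
    & forall j, j \in I ->
        lebesgue_measure (processing_times S (name j)) = (proc j)%:R%:E].

Definition opt_machines (I : seq job) (m : nat) : Prop :=
  (exists S, feasible m I S) /\
  (forall m', (exists S, feasible m' I S) -> (m <= m')%N).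

(* The decision taken at time [t] is a function of [m], [t] and the jobs
   released by time [t].  Past decisions need not be an argument: they are
   determined by the same data.  Machines are numbered by [nat], so their
   number need not be fixed in advance (the number of jobs is not known). *)
Definition semi_online_algorithm :=
  forall (m : nat) (t : R) (released : seq job), nat -> option nat.

Definition run (A : semi_online_algorithm) (m : nat) (I : seq job) :
    schedule R :=
  fun t => A m t [seq j <- I | (release j)%:~R <= t].

Definition competitive (A : semi_online_algorithm) (rho : nat -> R) : Prop :=
  forall (I : seq job) (m : nat), distinct_names I -> opt_machines I m ->
    exists K : nat,
      K%:R <= rho (size I) * m%:R /\ feasible K I (run A m I).

End Scheduling.

(* Main.v *)
Require Import Defs.
From mathcomp Require Import all_boot all_order all_algebra.
From mathcomp Require Import all_classical all_reals all_analysis.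
From mathcomp Require Import zify ring lra.
Import Order.TTheory GRing.Theory Num.Theory.
Import numFieldNormedType.Exports.

(** Time is cut into integer slots.  A job with laxity [l = d - r - p] is tight if
    [l <= p] and loose otherwise; loose jobs get [6 m] machines, tight jobs get
    [O(m log n_s)] machines in slot [s], where [n_s] jobs are known by then.  Within each
    group, priority goes to the jobs of smallest initial laxity.

    A feasible schedule on [m] machines satisfies the load bound: for every set [T'] of
    slots, the jobs have to be processed during [T'] for a total of at least
    [sum_j (|T' n I_j| - l_j)], which is thus at most [m |T'|].

    Suppose that job 0 starves, and let [T] be the slots of its window in which all
    machines of its group are busy, so [|T| > l_0].  If it is loose, all jobs busy in [T]
    live in an interval of length at most [6 l_0], so that their total work is at most
    [6 m l_0 < 6 m |T|].  If it is tight, let [x_j = |T n I_j|] for the jobs of higher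
    priority.  Jobs with [x_j < l_j / (n_j (n_j + 1))], where [n_j] jobs are known at the
    release of [j], contribute together at most [l_0 < |T|], because
    [sum_j 1 / (n_j (n_j + 1)) <= 1].  The others fall into [O(log n_j)] scales
    [x_j ~ l_j / 2^i].  For one scale, inflate [T] by a factor [2^i] on either side to
    [T']: then [T'] contains about [2^i x_j >= 2 l_j] slots of each window, so the load
    bound for [T'] shows that the scale contributes [O(m |T|)]. *)

Set Implicit Arguments.
Unset Strict Implicit.
Unset Printing Implicit Defensive.

(** * Inflating a set of slots by a given factor *)

Section Expansion.
Variable N : nat.

(** A queue of water flowing to the right: the truncated [.-1] is the unit absorbed by a slot, if
    there is any. The leftward flow is the same queue on the reflected set. *)
Fixpoint backlog (T : pred nat) (s : nat) : nat :=
  if s is s'.+1 then (backlog T s' + N * T s').-1 else 0.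

Definition served (T : pred nat) (s : nat) : bool := 0 < backlog T s + N * T s.

(** Conservation of water, slot by slot: what has entered is either absorbed or still queued. *)
Lemma backlog_served T u v : u <= v ->
  backlog T v + \sum_(u <= s < v) served T s =
  backlog T u + N * \sum_(u <= s < v) T s.
Proof.
move=> uv; rewrite -(subnK uv); elim: (v - u) => [|k IH].
  by rewrite !big_geq // muln0.
rewrite addSn !big_nat_recr ?leq_addl //= mulnDr {2}/served.
move: IH; move: (backlog T (k + u)) (N * T (k + u)) => b c; lia.
Qed.

(** A slot that absorbs nothing finds an empty queue, so all water brought since [u] was absorbed
    before it. *)
Lemma unserved_prefix T u v : u <= v -> ~~ served T v ->
  N * \sum_(u <= s < v) T s <= \sum_(u <= s < v) served T s.
Proof. by move=> uv; rewrite {1}/served => ?; have := backlog_served T uv; lia. Qed.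

Lemma sum_served T v :
  \sum_(0 <= s < v) served T s <= N * \sum_(0 <= s < v) T s.
Proof. by have := backlog_served T (leq0n v); rewrite /= => ?; lia. Qed.

Lemma sum_nat_reflect (F : nat -> nat) H u v : u <= v <= H ->
  \sum_(u <= s < v) F s = \sum_(H - v <= s < H - u) F (H - s.+1).
Proof.
move=> /andP[uv]; rewrite -(subnK uv); elim: (v - u) => [|k IH] kH.
  by rewrite !big_geq.
rewrite addSn big_nat_recr ?leq_addl //= IH; last by lia.
have -> : H - (k + u) = (H - (k + u).+1).+1 by lia.
rewrite [RHS]big_ltn; last by lia.
by rewrite addnC; congr (F _ + _); lia.
Qed.

(* Each slot of [T] brings [N] units of water, which flow once to the right and once to
   the left, each slot absorbing one unit per direction.  A slot of a window reached
   by neither flow splits the window: all water brought to its left (right) is absorbed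
   inside the window by the rightward (leftward) flow. *)
Lemma expansion (T : pred nat) (H : nat) : exists T' : pred nat,
  \sum_(0 <= s < H) T' s <= 2 * N * \sum_(0 <= s < H) T s /\
  forall r d, r <= d <= H ->
    minn (d - r) (N * \sum_(r <= s < d) T s) <= \sum_(r <= s < d) T' s.
Proof.
pose TL s := T (H - s.+1).
pose L s := served TL (H - s.+1).
have LE u v : u <= v <= H -> \sum_(u <= s < v) L s = \sum_(H - v <= s < H - u) served TL s.
  move=> uvH; rewrite (sum_nat_reflect _ uvH); apply: eq_big_nat => s sH.
  by rewrite /L; congr (nat_of_bool (served _ _)); lia.
have TE u v : u <= v <= H -> \sum_(u <= s < v) T s = \sum_(H - v <= s < H - u) TL s.
  by move=> uvH; rewrite (sum_nat_reflect _ uvH).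
exists (fun s => served T s || L s); split.
  apply: (@leq_trans (\sum_(0 <= s < H) (served T s + L s))).
    by apply: leq_sum => s _; case: (served T s); case: (L s).
  rewrite big_split /= mul2n -addnn mulnDl leq_add ?sum_served //.
  by rewrite LE ?leq0n ?leqnn // TE ?leq0n ?leqnn // subnn subn0 sum_served.
move=> r d /andP[rd dH].
have [/hasP[s] | /hasPn all_served] :=
    boolP (has (fun s => ~~ (served T s || L s)) (index_iota r d)); last first.
  rewrite geq_min (_ : d - r <= _) //.
  rewrite -[d - r]muln1 -sum_nat_const_nat [leqLHS]big_seq [leqRHS]big_seq.
  by apply: leq_sum => s /all_served /negPn ->.
rewrite mem_index_iota negb_or => /andP[rs sd] /andP[nR nL].
rewrite geq_min; apply/orP; right.
have Ts : N * T s = 0 by move: nR; rewrite /served -eqn0Ngt addn_eq0 => /andP[_ /eqP].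
have toR := unserved_prefix rs nR.
have toL : N * \sum_(s.+1 <= i < d) T i <= \sum_(s.+1 <= i < d) L i.
  rewrite LE ?TE ?sd //; apply: unserved_prefix; first by lia.
  by move: nL; rewrite /L.
rewrite !(@big_cat_nat _ _ _ s r d) ?(ltnW sd) //= !(big_ltn sd).
rewrite mulnDr mulnDr Ts add0n leq_add //.
  apply: leq_trans toR _; by apply: leq_sum => i _; case: (served T i).
apply: leq_trans toL _; rewrite (leq_trans _ (leq_addl _ _)) //.
by apply: leq_sum => i _; rewrite orbC; case: (L i).
Qed.
End Expansion.

(** * Weights that depend on the number of known jobs *)

Section Rank.
Local Open Scope ring_scope.

Definition rank_weight (c : nat) : rat := ((c * c.+1)%:R)^-1.

Lemma rank_weight_anti c c' : (0 < c <= c')%N -> rank_weight c' <= rank_weight c.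
Proof.
move=> /andP[c0 cc']; have c'0 := leq_trans c0 cc'.
by rewrite /rank_weight lef_pV2 ?posrE ?ltr0n ?muln_gt0 ?c0 ?c'0 // ler_nat leq_mul.
Qed.

(** In sorted order the [i]-th entry, counted from 1, has at least [i] entries below or equal to it,
    so its weight is at most [1 / (i (i + 1)) = 1 / i - 1 / (i + 1)], and the sum telescopes. Ties
    only lower the weights. *)
Lemma sum_rank_weight (s : seq nat) :
  \sum_(x <- s) rank_weight (count (fun y => y <= x)%N s) <= 1.
Proof.
suff sorted_case (u : seq nat) : sorted leq u ->
    \sum_(x <- u) rank_weight (count (fun y => y <= x)%N u) <= 1 - (size u).+1%:R^-1.
  have ss : perm_eq s (sort leq s) by rewrite perm_sym perm_sort.
  rewrite (perm_big _ ss) /=.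
  under eq_bigr do rewrite (permP ss).
  by apply: le_trans (sorted_case _ (sort_sorted leq_total s)) _; rewrite gerBl invr_ge0 ler0n.
elim/last_ind: u => [|u x IH] sux; first by rewrite big_nil subrr.
have su : sorted leq u by apply: subseq_sorted sux; [exact: leq_trans | exact: subseq_rcons].
have ux : all (fun y => y <= x)%N u.
  by move: sux; rewrite (sorted_pairwise leq_trans) pairwise_rcons => /andP[].
rewrite -cats1 big_cat big_seq1 /= size_cat addn1 count_cat /= leqnn addn0.
rewrite (_ : count _ u = size u); last by apply/eqP; rewrite -all_count.
rewrite addn1 /rank_weight.
apply: (@le_trans _ _ (1 - (size u).+1%:R^-1 + rank_weight (size u).+1)).
  rewrite lerD2r; apply: le_trans (IH su); rewrite big_seq [leRHS]big_seq.
  apply: ler_sum => y yu; apply: rank_weight_anti; rewrite count_cat leq_addr andbT.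
  by rewrite -has_count; apply/hasP; exists y.
rewrite le_eqVlt; apply/orP; left; apply/eqP; rewrite /rank_weight.
have n1 : (size u).+1%:R != 0 :> rat by rewrite pnatr_eq0.
have n2 : (size u).+2%:R != 0 :> rat by rewrite pnatr_eq0.
move: n2; rewrite natrM -[(size u).+2%:R]natr1; move: (size u).+1%:R n1 => k n1 n2.
by field; apply/andP.
Qed.
End Rank.

(* Bounds the number of scales of a job at whose release [c] jobs are known. *)
Definition phases (c : nat) : nat := 2 * trunc_log 2 c + 3.

Lemma phases_homo : {homo phases : a b / a <= b}.
Proof. by move=> a b ab; rewrite leq_add2r leq_mul2l /= leq_trunc_log. Qed.

(** Ensures that a job with [x_j >= l_j / (c (c + 1))] reaches [2 l_j] after at most [phases c]
    doublings of [x_j]. *)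
Lemma expn_phases c : 2 * (c * c.+1) <= 2 ^ phases c.
Proof.
have c2 : c.+1 <= 2 ^ (trunc_log 2 c).+1 by exact: trunc_log_ltn.
rewrite /phases (_ : 2 * _ + 3 = ((trunc_log 2 c).+1 + (trunc_log 2 c).+1).+1); last by lia.
by rewrite expnS expnD leq_mul2l /= leq_mul // (leq_trans _ c2).
Qed.

(** * Consequences of the load bound for tight and loose jobs *)

Section Load.
Variables (J : eqType) (I : seq J) (r d p : J -> nat) (m H : nat).

Let laxity j := d j - r j - p j.
Let inside (T : pred nat) j := \sum_(r j <= s < d j) T s.

(* The subtraction is truncated: a job with enough laxity does not load [T]. *)
Definition load_bound := forall T : pred nat,
  \sum_(j <- I) (\sum_(r j <= s < d j) T s - (d j - r j - p j)) <= m * \sum_(0 <= s < H) T s.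

Hypothesis window : {in I, forall j, r j + p j <= d j <= H}.
Hypothesis load : load_bound.

Lemma inside_le T j : inside T j <= d j - r j.
Proof.
rewrite -[leqRHS]muln1 -sum_nat_const_nat; apply: leq_sum => s _; exact: leq_b1.
Qed.

(** The constant 8 is 4 times 2: at least a quarter of [2 ^ i * inside T j] is mandatory in the
    inflated set, which has at most [2 * 2 ^ i] times as many slots as [T]. The factor [2 ^ i]
    cancels. *)
Lemma scale_bound (T : pred nat) (G : pred J) (i : nat) :
  {in I, forall j, G j -> [/\ laxity j <= p j, 2 * laxity j <= 2 ^ i * inside T j
    & (i == 0) || (2 ^ i * inside T j <= 4 * laxity j)]} ->
  \sum_(j <- I | G j) inside T j <= 8 * m * \sum_(0 <= s < H) T s.
Proof.
move=> GP; have [T' [T'le T'ge]] := expansion (2 ^ i) T H.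
have i0 : 0 < 2 ^ i by rewrite expn_gt0.
(* [T'] contains the whole window or at least [2 ^ i * inside T j] of its slots. In the latter case
   at least half remains after subtracting the laxity. In the former [p j >= laxity j] remains,
   which is at least a quarter if [i > 0]; for [i = 0] the latter case always applies, since
   [inside T j] is at most the window length. *)
have mandatory j : j \in I -> G j -> 2 ^ i * inside T j <= 4 * (inside T' j - laxity j).
  move=> jI Gj; have [lp l2 l4] := GP j jI Gj.
  have /andP[rpd dH] := window jI.
  have := T'ge (r j) (d j); rewrite dH andbT => /(_ (leq_trans (leq_addr _ _) rpd)).
  have := inside_le T j; rewrite -/(inside T j) -/(inside T' j).
  move: (inside T' j) => y; move: l2 l4; rewrite /laxity in lp *.
  case: (posnP i) => [-> | ni]; first by rewrite expn0 !mul1n; lia.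
  by move: (2 ^ i * _) => z; lia.
rewrite -(leq_pmul2l i0) big_distrr /=.
apply: (@leq_trans (4 * \sum_(j <- I) (inside T' j - laxity j))).
  rewrite big_distrr [leqRHS](bigID G) /= -[leqLHS]addn0 leq_add //.
  rewrite big_seq_cond [leqRHS]big_seq_cond.
  by apply: leq_sum => j /andP[]; exact: mandatory.
have := load T'; rewrite -/inside => /(leq_mul (leqnn 4)) /leq_trans; apply.
have := leq_mul (leqnn (4 * m)) T'le; lia.
Qed.

Let known s := count (fun j => r j <= s) I.

Lemma known_homo : {homo known : s t / s <= t}.
Proof. by move=> s t st; apply: sub_count => j /= /leq_trans; apply. Qed.

Lemma sum_leq_const B k : \sum_(0 <= i < B) (i <= k) <= k.+1.
Proof.
have -> : \sum_(0 <= i < B) (i <= k) = minn B k.+1; last exact: geq_minr.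
by elim: B => [|B IH]; [rewrite big_geq | rewrite big_nat_recr //= IH; lia].
Qed.

Lemma tight_load (T : pred nat) (P : pred J) (l0 : nat) :
  {in I, forall j, P j -> laxity j <= minn l0 (p j)} ->
  \sum_(j <- I | P j) inside T j <=
  \sum_(0 <= s < H) T s * (8 * m * (phases (known s)).+1) + l0.
Proof.
move=> Plax; pose L j := phases (known (r j)).
pose good j := 2 * laxity j <= 2 ^ L j * inside T j.
rewrite (bigID good) /= leq_add //; last first.
  rewrite -(ler_nat rat) natr_sum.
  apply: (@le_trans _ _ (\sum_(j <- I) l0%:R * rank_weight (known (r j)))%R); last first.
    rewrite -mulr_sumr -[leRHS]mulr1 ler_wpM2l ?ler0n //.
    have := sum_rank_weight (map r I); rewrite big_map.
    by under eq_bigr do rewrite count_map.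
  rewrite [leRHS](bigID (fun j => P j && ~~ good j)) /= -[leLHS]addr0 lerD //; last first.
    apply: sumr_ge0 => j _; rewrite mulr_ge0 ?ler0n // invr_ge0 ler0n //.
  rewrite big_seq_cond [leRHS]big_seq_cond; apply: ler_sum => j /and3P[jI Pj bad].
  have kj : 0 < known (r j) by rewrite -has_count; apply/hasP; exists j.
  rewrite ler_pdivlMr ?ltr0n ?muln_gt0 ?kj // -natrM ler_nat.
  (* With [c] jobs known at its release, a job that is not good has
     [inside T j * (c * c.+1) < l0]. *)
  have := expn_phases (known (r j)); move: bad (Plax j jI Pj).
  rewrite /good -ltnNge leq_min -/(L j) => bad /andP[ll0 _].
  move/(leq_mul (leqnn (inside T j))); move: (_ * _.+1) => c; lia.
pose G i j := [&& P j, 0 < inside T j, i <= L j, 2 * laxity j <= 2 ^ i * inside T j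
  & (i == 0) || (2 ^ i * inside T j <= 4 * laxity j)].
(* Restricting [T] makes the bound depend on the slot: a slot [s] pays only for scales up to
   [phases (known s)]. A job of scale [i <= L j] loses no slot of its window, because [known] is
   monotone. *)
pose Ti i : pred nat := fun s => T s && (i <= phases (known s)).
pose B := (phases (size I)).+1.
have LB j : L j < B by rewrite ltnS phases_homo // count_size.
apply: (@leq_trans (\sum_(j <- I) \sum_(0 <= i < B | G i j) inside T j)).
  rewrite [leqRHS](bigID (fun j => P j && good j)) /= -[leqLHS]addn0 leq_add //.
  apply: leq_sum => j /andP[Pj gj].
  have [-> // | x0] := posnP (inside T j).
  have ex : exists i, 2 * laxity j <= 2 ^ i * inside T j by exists (L j).
  (* The scale of a good job is the least exponent that reaches [2 * laxity j]; minimality gives the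
     upper bound [4 * laxity j] unless the exponent is 0. *)
  pose i := ex_minn ex; have Gi : G i j.
    rewrite /G Pj x0 /i /=; case: ex_minnP => k k1 kmin; rewrite kmin // k1 /=.
    case: k k1 kmin => [//|k] k1 kmin; apply/orP; right.
    have : ~~ (2 * laxity j <= 2 ^ k * inside T j) by apply/negP => /kmin; rewrite ltnn.
    by rewrite -ltnNge expnS; lia.
  have iB : i < B by apply: leq_ltn_trans (LB j); case/and4P: Gi.
  rewrite big_mkcond (bigD1_seq i) ?mem_index_iota ?iota_uniq //= Gi; exact: leq_addr.
rewrite (exchange_big_dep xpredT) //=.
apply: (@leq_trans (\sum_(0 <= i < B) 8 * m * \sum_(0 <= s < H) Ti i s)).
  apply: leq_sum => i _.
  have TiE j : G i j -> inside (Ti i) j = inside T j.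
    case/and5P=> _ _ iL _ _; apply: eq_big_nat => s /andP[rs _].
    by rewrite /Ti (leq_trans iL) ?andbT // phases_homo // known_homo.
  rewrite -(eq_bigr _ TiE); apply: (@scale_bound _ _ i) => j jI Gj.
  rewrite TiE //; case/and5P: Gj => Pj _ _ -> ->; split=> //.
  by have := Plax j jI Pj; rewrite leq_min => /andP[].
rewrite -big_distrr exchange_big big_distrr /=; apply: leq_sum => s _.
rewrite mulnCA leq_mul2l; apply/orP; right.
rewrite /Ti; case: (T s) => /=; last by rewrite big1.
by rewrite mul1n sum_leq_const.
Qed.

(** A window that meets [T] has length at most [2 * l0], so it lies in [[r0, d0)] widened by
    [2 * l0] on both sides, an interval of at most [6 * l0] slots in which all its work is
    mandatory. A window that misses [T] has [x j = 0]. *)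
Lemma loose_load (T : pred nat) (P : pred J) (x : J -> nat) (r0 d0 l0 : nat) :
  (forall u, T u -> r0 <= u < d0) -> d0 - r0 <= 2 * l0 ->
  {in I, forall j, P j -> p j <= laxity j <= l0} ->
  {in I, forall j, P j -> x j <= minn (p j) (inside T j)} ->
  \sum_(j <- I | P j) x j <= 6 * m * l0.
Proof.
move=> Tin len Plax xle.
pose T' : pred nat := fun u => r0 - 2 * l0 <= u < d0 + 2 * l0.
apply: (@leq_trans (m * \sum_(0 <= s < H) T' s)); last first.
  rewrite -mulnA mulnCA leq_mul2l; apply/orP; right.
  apply: (@leq_trans ((d0 + 2 * l0) - (r0 - 2 * l0))); last by lia.
  have -> : forall k, \sum_(0 <= s < k) T' s = minn (d0 + 2 * l0) k - minn (r0 - 2 * l0) k.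
    by elim=> [|k IH]; [rewrite big_geq | rewrite big_nat_recr //= IH /T'; lia].
  by lia.
apply: leq_trans (load T'); rewrite [leqRHS](bigID P) /= -[leqLHS]addn0 leq_add //.
rewrite big_seq_cond [leqRHS]big_seq_cond; apply: leq_sum => j /andP[jI Pj].
have := xle j jI Pj; rewrite leq_min => /andP[xp].
rewrite /inside; have [/hasP[u] | /hasPn none] := boolP (has T (index_iota (r j) (d j))).
  rewrite mem_index_iota => uw /Tin uw' _.
  have := Plax j jI Pj; have := window jI => /andP[w1 w2]; rewrite /laxity => lj.
  have -> : \sum_(r j <= s < d j) T' s = d j - r j.
    rewrite -[RHS]muln1 -sum_nat_const_nat; apply: eq_big_nat => s sw.
    by have -> : T' s by rewrite /T'; lia.
  by lia.
rewrite big_nat_cond big1 ?leqn0 => [/eqP -> // | s]; rewrite andbT -mem_index_iota.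
by move/none/negPf->.
Qed.
End Load.

Local Open Scope classical_set_scope.
Local Open Scope ring_scope.

(** * The priority rule on integer slots *)

Section Greedy.

Definition lax (j : job) : int := deadline j - release j - (proc j)%:Z.
(** Sorting by this relation puts large laxities first, because the list is read with increasing
    priority. *)
Definition lax_ge (i j : job) : bool := lax j <= lax i.

Lemma lax_ge_total : total lax_ge.
Proof. by move=> i j; exact: le_total. Qed.

Lemma lax_ge_trans : transitive lax_ge.
Proof. by move=> j i k ij jk; exact: le_trans jk ij. Qed.

(* Counts slots of the interval from [a] to [b]; meaningful only for [a <= b]. *)
Definition elapsed (f : pred int) (a b : int) : nat :=
  count (fun i : nat => f (a + i%:Z)) (iota 0 `|b - a|).

Implicit Types (cap : int -> nat) (js : seq job) (s : int).

(* The head of the list has the lowest priority. *)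
Fixpoint running cap js s : seq job :=
  if js is j :: js' then
    let free u := (size (running cap js' u) < cap u)%N in
    if [&& release j <= s < deadline j, free s & (elapsed free (release j) s < proc j)%N]
    then j :: running cap js' s else running cap js' s
  else [::].

Lemma running_subseq cap js s : subseq (running cap js s) js.
Proof.
elim: js => //= j js IH; case: ifP => _; first by rewrite eqxx.
by apply: subseq_trans IH (subseq_cons _ _).
Qed.

Lemma size_running cap js s : (size (running cap js s) <= cap s)%N.
Proof. by elim: js => //= j js IH; case: ifP => // /and3P[]. Qed.

Lemma running_window cap js s j :
  j \in running cap js s -> release j <= s < deadline j.
Proof.
elim: js => //= i js IH; case: ifP => [/andP[iw _]|_] //.
by rewrite inE => /predU1P[-> |].
Qed.

(** Times after [s] are never consulted, and a job released later fails its window test. This is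
    what makes the rule semi-online. *)
Lemma running_local cap cap' js s : (forall u, u <= s -> cap u = cap' u) ->
  forall u, u <= s ->
  running cap js u = running cap' [seq j <- js | release j <= s] u.
Proof.
move=> capE; elim: js => //= j js IH u us.
case: (leP (release j) s) => [rs | sr] /=; last first.
  by rewrite leNgt (le_lt_trans us sr) /= IH.
case: (leP (release j) u) => ru /=; last exact: IH.
rewrite -!(IH _ us) -!capE //; congr (if _ && (_ && _) then _ else _).
congr (_ < _)%N; apply: eq_in_count => i; rewrite mem_iota => iu.
have ius : release j + i%:Z <= s by move: iu us ru; lia.
by rewrite -IH // capE.
Qed.

(** A job takes every free slot until it is finished, so the work done so far can be read off from
    the number of free slots since its release. Hence [running] needs no recursion on time. *)
Lemma greedy_count (f : pred nat) (q n : nat) :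
  count (fun i => f i && (count f (iota 0 i) < q)%N) (iota 0 n) =
  minn q (count f (iota 0 n)).
Proof.
elim: n => [|n IH]; first by rewrite minn0.
rewrite -addn1 iotaD !count_cat IH /= !addn0 add0n.
by move: (count f _) => c; case: (f n) => /=; case: ltnP => /=; lia.
Qed.

Lemma mem_running_cons cap js j s : j \notin js ->
  (j \in running cap (j :: js) s) =
  [&& release j <= s < deadline j, (size (running cap js s) < cap s)%N &
      (elapsed (fun u => size (running cap js u) < cap u)%N (release j) s < proc j)%N].
Proof.
move=> jjs /=; case: ifP => _; first by rewrite mem_head.
by apply/negP => /(mem_subseq (running_subseq _ _ _)); apply/negP.
Qed.

Lemma mem_running_cat cap js1 js2 j s : j \notin js1 ->
  (j \in running cap (js1 ++ js2) s) = (j \in running cap js2 s).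
Proof.
elim: js1 => //= i js1 IH; rewrite inE negb_or => /andP[/negPf ji /IH <-].
by case: ifP => // _; rewrite inE ji.
Qed.

(** The jobs of [js1] have lower priority and do not affect [j]; the rest is [greedy_count]. *)
Lemma elapsed_running cap js1 js2 j :
  release j <= deadline j -> uniq (js1 ++ j :: js2) ->
  elapsed (fun s => j \in running cap (js1 ++ j :: js2) s) (release j) (deadline j) =
  minn (proc j) (elapsed (fun s => size (running cap js2 s) < cap s)%N (release j) (deadline j)).
Proof.
move=> rd; rewrite cat_uniq /= => /and3P[_ /norP[j1 _] /andP[j2 _]].
rewrite /elapsed -greedy_count; apply: eq_in_count => i; rewrite mem_iota add0n /= => id.
rewrite mem_running_cat // mem_running_cons //.
have -> : (release j <= release j + i%:Z < deadline j) by lia.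
by rewrite /elapsed /= addrC addKr.
Qed.

End Greedy.

(** * A starving job contradicts the load bound *)

Lemma count_sum (T : Type) (a : pred T) (s : seq T) :
  count a s = (\sum_(x <- s) a x)%N.
Proof. by rewrite -sum1_count big_mkcond; apply: eq_bigr => x _; case: (a x). Qed.

Lemma uniq_size_le (T : eqType) (A I : seq T) (P : pred T) : uniq A ->
  {in A, forall x, (x \in I) && P x} ->
  (size A <= \sum_(x <- I | P x) (x \in A))%N.
Proof.
move=> uA AI; rewrite -big_filter -count_sum -size_filter; apply: uniq_leq_size => // x xA.
by rewrite !mem_filter xA /= andbC AI.
Qed.

Lemma sum_support (F : nat -> nat) a b H : (a <= b <= H)%N ->
  (forall u, F u != 0 -> a <= u < b)%N ->
  (\sum_(0 <= u < H) F u = \sum_(a <= u < b) F u)%N.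
Proof.
move=> /andP[ab bH] F0; rewrite (@big_cat_nat _ _ _ a) //=; last exact: leq_trans bH.
rewrite [X in (_ + X)%N](@big_cat_nat _ _ _ b) //=.
rewrite big_nat_cond big1 ?add0n => [|u]; last first.
  by move=> uw; apply/eqP/negPn/negP => /F0; lia.
rewrite [X in (_ + X)%N]big_nat_cond [X in (_ + X)%N]big1 ?addn0 // => u.
by move=> uw; apply/eqP/negPn/negP => /F0; lia.
Qed.

Definition tight (j : job) : bool := lax j <= (proc j)%:Z.

Definition known (I : seq job) (s : int) : nat := count (fun j => release j <= s) I.

Definition loose_machines (m : nat) : nat := 6 * m.

(** The coefficient of a slot in [tight_load], plus [m] further machines that pay for the term
    [l0]. *)
Definition tight_machines (m n : nat) : nat := m * (8 * (phases n).+1).+1.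

Section Completion.
Variables (I : seq job) (m H : nat) (lo : int).

(** Integer times are shifted by [lo] to natural slots; the absolute values are exact since no
    window starts before [lo]. *)
Let r j := `|release j - lo|%N.
Let d j := `|deadline j - lo|%N.
Let slot (u : nat) : int := lo + u%:Z.

Hypothesis uniqI : uniq I.
Hypothesis window : {in I, forall j,
  lo <= release j /\ release j + (proc j)%:Z <= deadline j <= lo + H%:Z}.
Hypothesis load : load_bound I r d proc m H.

Lemma nat_window : {in I, forall j, r j + proc j <= d j <= H}%N.
Proof. by move=> j /window; rewrite /r /d; lia. Qed.

Lemma nat_lax : {in I, forall j, lax j = (d j - r j - proc j)%N}.
Proof. by move=> j /window; rewrite /r /d /lax; lia. Qed.

Lemma elapsed_sum (f : pred int) : {in I, forall j,
  elapsed f (release j) (deadline j) = \sum_(r j <= u < d j) f (slot u)}%N.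
Proof.
move=> j /window jw; rewrite /elapsed count_sum -{1}[r j]add0n big_addn.
rewrite /index_iota subn0 (_ : `|deadline j - release j|%N = (d j - r j)%N); last first.
  by rewrite /d /r; lia.
apply: eq_bigr => i _; congr (nat_of_bool (f _)).
by rewrite /r /slot; lia.
Qed.

(** [T] consists of the slots of the window of [j] in which jobs of higher priority fill all
    machines, and [x i] counts those in which [i] runs. An unfinished job has met fewer than
    [proc j] free slots, so more than [lax j] slots are left for [T]. *)
Lemma starved cap js j : uniq js -> sorted lax_ge js -> {subset js <= I} -> j \in js ->
  (elapsed (fun s => j \in running cap js s) (release j) (deadline j) < proc j)%N ->
  exists (T : pred nat) (x : job -> nat),
  [/\ forall u, T u -> (r j <= u < d j)%N,
      lax j < (\sum_(0 <= u < H) T u)%N,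
      {in I, forall i, x i <= minn (proc i) (\sum_(r i <= u < d i) T u)}%N &
      (\sum_(0 <= u < H) T u * cap (slot u) <=
       \sum_(i <- I | (i \in js) && (lax i <= lax j)%R) x i)%N].
Proof.
move=> ujs sjs jsI jjs.
have jI := jsI _ jjs; have [w1 w2] := window jI.
have /andP[nw1 nw2] := nat_window jI.
case/splitPr: jjs ujs sjs jsI => js1 js2 ujs sjs jsI.
rewrite elapsed_running ?elapsed_sum //; last by lia.
pose free u := (size (running cap js2 (slot u)) < cap (slot u))%N.
rewrite gtn_min ltnn /= => starve_raw.
have starve : (\sum_(r j <= u < d j) free u < proc j)%N by exact: starve_raw.
pose T : pred nat := fun u => (r j <= u < d j)%N && ~~ free u.
pose x i := (\sum_(0 <= u < H) (T u && (i \in running cap js2 (slot u))))%N.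
have js2I : {subset js2 <= I} by move=> i i2; rewrite jsI // mem_cat inE i2 !orbT.
have u2 : uniq js2 by move: ujs; rewrite cat_uniq /= => /and3P[_ _ /andP[]].
have lax2 i : i \in js2 -> lax i <= lax j.
  move=> i2; move: sjs; rewrite (sorted_pairwise lax_ge_trans) pairwise_cat /=.
  by case/and4P=> _ _ /allP/(_ i i2).
exists T, x; split.
- by move=> u /andP[].
- rewrite (nat_lax jI) ltz_nat.
  have -> : (\sum_(0 <= u < H) T u = \sum_(r j <= u < d j) ~~ free u)%N.
    rewrite (@sum_support _ (r j) (d j)); first last.
    - by move=> u; rewrite /T; case: (_ <= u < _)%N.
    - by lia.
    by apply: eq_big_nat => u uw; rewrite /T uw.
  have : (\sum_(r j <= u < d j) free u + \sum_(r j <= u < d j) ~~ free u = d j - r j)%N.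
    rewrite -big_split /= -[RHS]muln1 -sum_nat_const_nat; apply: eq_bigr => u _.
    by case: (free u).
  by move: starve; lia.
- move=> i iI; have [i2 | i2] := boolP (i \in js2); last first.
    rewrite /x big1 // => u _; rewrite andbC.
    by case: (boolP (i \in _)) => // /(mem_subseq (running_subseq _ _ _)); rewrite (negPf i2).
  have xE : x i = (\sum_(r i <= u < d i) (T u && (i \in running cap js2 (slot u))))%N.
    apply: sum_support => [|u]; first by have := nat_window iI; lia.
    case: (boolP (i \in _)) => [/running_window iw _|]; last by rewrite andbF.
    by have := window iI; move: iw; rewrite /slot /r /d; lia.
  rewrite xE leq_min; apply/andP; split; last first.
    by apply: leq_sum => u _; case: (T u) => //=; exact: leq_b1.
  apply: (@leq_trans (\sum_(r i <= u < d i) (i \in running cap js2 (slot u)))%N).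
    by apply: leq_sum => u _; case: (T u).
  rewrite -(elapsed_sum (fun s => i \in running cap js2 s)) //.
  case/splitPr: i2 u2 => a b u2; rewrite elapsed_running ?geq_minl //.
  by have := window iI; lia.
- rewrite exchange_big /=; apply: leq_sum => u _; rewrite /T.
  have [uw | //] := boolP (_ <= u < _)%N; have [// | /=] := boolP (free u).
  rewrite -leqNgt mul1n => /leq_trans; apply; apply: uniq_size_le.
    exact: subseq_uniq (running_subseq _ _ _) u2.
  move=> i /(mem_subseq (running_subseq _ _ _)) i2.
  by rewrite js2I // lax2 // mem_cat inE i2 !orbT.
Qed.

Lemma running_at_most cap js j : uniq js -> j \in js -> j \in I ->
  (elapsed (fun s => j \in running cap js s) (release j) (deadline j) <= proc j)%N.
Proof.
move=> ujs jjs jI; case/splitPr: jjs ujs => a b uab.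
by rewrite elapsed_running ?geq_minl //; have := window jI; lia.
Qed.

Lemma machines_gt0 j : j \in I -> (0 < proc j)%N -> (0 < m)%N.
Proof.
move=> jI p0; have := load predT; case: (posnP m) => // -> .
rewrite mul0n leqn0 (big_rem _ jI) /= addn_eq0 => /andP[+ _].
under eq_bigr do rewrite /=; rewrite sum_nat_const_nat muln1.
by have := nat_window jI; lia.
Qed.

Lemma loose_complete js j : uniq js -> sorted lax_ge js -> {subset js <= I} ->
  {in js, forall i, ~~ tight i} -> j \in js ->
  elapsed (fun s => j \in running (fun=> loose_machines m) js s) (release j) (deadline j)
    = proc j.
Proof.
move=> ujs sjs jsI loose jjs; have jI := jsI _ jjs.
apply/eqP; rewrite eqn_leq running_at_most //= leqNgt; apply/negP => unfinished.
have m0 : (0 < m)%N by apply: (machines_gt0 jI); apply: leq_ltn_trans unfinished.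
have [T [x [Tw Tlax xle]]] := starved ujs sjs jsI jjs unfinished.
rewrite -big_distrl /= => work.
move: Tlax; rewrite (nat_lax jI) ltz_nat => Tlax.
have : (\sum_(i <- I | (i \in js) && (lax i <= lax j)%R) x i <=
    6 * m * (d j - r j - proc j))%N.
  apply: (loose_load nat_window load Tw) => [|i iI /andP[ijs]|i iI _].
  - by have := loose _ jjs; rewrite /tight (nat_lax jI) lez_nat; lia.
  - have := loose _ ijs; rewrite /tight !nat_lax // !lez_nat -ltnNge => /ltnW -> /=; exact.
  - exact: xle.
rewrite leqNgt => /negP; apply; apply: leq_trans work.
by rewrite mulnC ltn_pmul2r // muln_gt0.
Qed.

Lemma tight_complete js j : uniq js -> sorted lax_ge js -> {subset js <= I} ->
  {in js, forall i, tight i} -> j \in js ->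
  elapsed (fun s => j \in running (fun u => tight_machines m (known I u)) js s)
    (release j) (deadline j) = proc j.
Proof.
move=> ujs sjs jsI tightjs jjs; have jI := jsI _ jjs.
apply/eqP; rewrite eqn_leq running_at_most //= leqNgt; apply/negP => unfinished.
have m0 : (0 < m)%N by apply: (machines_gt0 jI); apply: leq_ltn_trans unfinished.
have [T [x [Tw Tlax xle]]] := starved ujs sjs jsI jjs unfinished.
rewrite (nat_lax jI) ltz_nat in Tlax; rewrite leqNgt => /negP; apply.
pose P i := (i \in js) && (lax i <= lax j).
have xle' : (\sum_(i <- I | P i) x i <= \sum_(i <- I | P i) \sum_(r i <= u < d i) T u)%N.
  rewrite big_seq_cond [leqRHS]big_seq_cond; apply: leq_sum => i /andP[iI _].
  by have := xle i iI; rewrite leq_min => /andP[].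
apply: leq_ltn_trans xle' _.
have := tight_load nat_window load T (P := P) (l0 := (d j - r j - proc j)%N).
move/(_ _)/leq_ltn_trans; apply.
  move=> i iI /andP[ijs]; rewrite (nat_lax iI) (nat_lax jI) lez_nat leq_min => -> /=.
  by have := tightjs _ ijs; rewrite /tight (nat_lax iI) lez_nat.
pose A u := (8 * m * (phases (count (fun j => r j <= u) I)).+1)%N.
(* As [l0 < |T|], one more unit per slot of [T] pays for [l0]; since [m > 0], the extra [m] machines
   cover this unit. *)
apply: (@leq_trans (\sum_(0 <= u < H) (T u * A u + T u))%N).
  by rewrite big_split ltn_add2l.
apply: leq_sum => u _; rewrite -[X in (_ + X)%N]muln1 -mulnDr leq_mul2l.
rewrite (_ : known I (slot u) = count (fun j => r j <= u)%N I); last first.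
  by apply: eq_in_count => i /window iw; rewrite /slot /r; lia.
by apply/orP; right; rewrite /A /tight_machines [leqRHS]mulnS mulnA [(m * 8)%N]mulnC addnC leq_add2r.
Qed.
End Completion.

(** * From schedules in continuous time to the load bound on slots *)

Section SlotMeasure.
Variable R : realType.
Let mu : set R -> \bar R := @lebesgue_measure R.

(** Half-open, so that the slots partition the line and the floor of a time names its slot. *)
Definition unit_slot (z : int) : set R := `[z%:~R, (z + 1)%:~R[.

Lemma floor_unit_slot (t : R) (z : int) : (Num.floor t == z) = (t \in unit_slot z).
Proof.
by rewrite floor_eq; apply/idP/idP; rewrite /unit_slot inE /= in_itv.
Qed.

Lemma measurable_unit_slot z : measurable (unit_slot z).
Proof. exact: measurable_itv. Qed.

Lemma measure_unit_slot z : mu (unit_slot z) = 1%E.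
Proof.
rewrite /mu lebesgue_measure_itv /= lte_fin ltr_int ltrDl ltr01 -EFinD -intrB.
by rewrite addrAC subrr add0r.
Qed.

Lemma measure_bigcup_seq (K : choiceType) (s : seq K) (F : K -> set R) : uniq s ->
  {in s, forall i, measurable (F i)} -> trivIset [set` s] F ->
  mu (\bigcup_(i in [set` s]) F i) = (\sum_(i <- s) mu (F i))%E.
Proof.
by move=> us mF tF; rewrite /mu measure_fin_bigcup // (fsbig_seq _ _ us).
Qed.

Lemma measure_bigcup_seq_le (K : choiceType) (s : seq K) (A : set R) (F : K -> set R) :
  uniq s -> {in s, forall i, measurable (F i)} -> measurable A ->
  A `<=` \bigcup_(i in [set` s]) F i -> (mu A <= \sum_(i <- s) mu (F i))%E.
Proof.
move=> us mF mA AF; by rewrite fsbig_seq //; apply: content_sub_fsum.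
Qed.

Variables (I : seq job) (m : nat) (S : schedule R).
Hypothesis feasibleS : feasible m I S.

Lemma processing_timesE i :
  processing_times S i = \bigcup_(k in [set` iota 0 m]) [set t | S t k = Some i].
Proof.
case: feasibleS => bound _ _ _; apply/seteqP; split=> t /=.
  by case=> k Sk; exists k => //=; rewrite mem_iota; have [] := bound _ _ _ Sk.
by case=> k _ Sk; exists k.
Qed.

Lemma measurable_processing i : measurable (processing_times S i).
Proof.
rewrite processing_timesE; apply: fin_bigcup_measurable => // k _.
by case: feasibleS.
Qed.

(** On each machine, different names have disjoint processing sets inside a slot of measure 1;
    summing over the [m] machines gives the bound. *)
Lemma slot_capacity (names : seq nat) z : uniq names ->
  (\sum_(i <- names) mu (processing_times S i `&` unit_slot z) <= m%:R%:E)%E.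
Proof.
move=> un; pose E k i := [set t | S t k = Some i] `&` unit_slot z.
have mE k i : measurable (E k i).
  by apply: measurableI; [case: feasibleS | exact: measurable_unit_slot].
apply: (@le_trans _ _ (\sum_(i <- names) \sum_(k <- iota 0 m) mu (E k i))%E).
  apply: lee_sum => i _; apply: measure_bigcup_seq_le => //; first exact: iota_uniq.
    by apply: measurableI; [exact: measurable_processing | exact: measurable_unit_slot].
  by rewrite processing_timesE setI_bigcupl.
rewrite exchange_big /=; apply: (@le_trans _ _ (\sum_(k <- iota 0 m) 1%E)%E).
  apply: lee_sum => k _; rewrite -measure_bigcup_seq // -?(measure_unit_slot z).
    apply: le_measure; rewrite ?inE; [|exact: measurable_unit_slot|].
      by apply: fin_bigcup_measurable => // i _; exact: mE.
    by move=> t [i _ []].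
  by move=> i j _ _ [t [[/= Si _] [+ _]]]; rewrite /= Si => -[].
rewrite (eq_bigr (fun=> 1%:E)) // sumEFin big_const_seq count_predT size_iota.
by rewrite iter_addr_0.
Qed.

Definition slot_share (i : nat) (z : int) : R :=
  fine (mu (processing_times S i `&` unit_slot z)).

Lemma measurable_share i z : measurable (processing_times S i `&` unit_slot z).
Proof. by apply: measurableI; [exact: measurable_processing | exact: measurable_unit_slot]. Qed.

Lemma measure_share_le1 i z : (mu (processing_times S i `&` unit_slot z) <= 1)%E.
Proof.
rewrite -(measure_unit_slot z); apply: le_measure => //; rewrite ?inE.
- exact: measurable_share.
- exact: measurable_unit_slot.
Qed.

Lemma slot_shareE i z :
  mu (processing_times S i `&` unit_slot z) = (slot_share i z)%:E.
Proof.
rewrite fineK // ge0_fin_numE; last exact: measure_ge0.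
by rewrite (le_lt_trans (measure_share_le1 i z)) // ltry.
Qed.

Lemma slot_share_ge0 i z : 0 <= slot_share i z.
Proof. by rewrite fine_ge0 // measure_ge0. Qed.

Lemma slot_share_le1 i z : slot_share i z <= 1.
Proof. by rewrite -lee_fin -slot_shareE measure_share_le1. Qed.

Lemma slot_share_capacity names z : uniq names ->
  \sum_(i <- names) slot_share i z <= m%:R.
Proof.
move=> un; rewrite -lee_fin -sumEFin; under eq_bigr do rewrite -slot_shareE.
exact: slot_capacity.
Qed.

Lemma processing_window j t : uniq (map name I) -> j \in I ->
  processing_times S (name j) t -> (release j)%:~R <= t <= (deadline j)%:~R.
Proof.
move=> uI jI [k Sk]; case: feasibleS => /(_ _ _ _ Sk)[_ [i [iI ij iw]]] _ _ _.
suff -> : j = i by [].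
have /uniqP inj := uI; have := inj 0%N (index j I) (index i I).
rewrite !inE !size_map !index_mem => /(_ jI iI).
rewrite !(nth_map j) ?index_mem // !nth_index // ij => /(_ erefl) ji.
by rewrite -(nth_index j jI) ji nth_index.
Qed.

Lemma slot_share_proc j (lo : int) : uniq (map name I) -> j \in I ->
  lo <= release j <= deadline j ->
  (proc j)%:R <= \sum_(`|release j - lo|%N <= u < `|deadline j - lo|%N)
    slot_share (name j) (lo + u%:Z).
Proof.
move=> uI jI /andP[lor rd]; rewrite -lee_fin -sumEFin.
set a := `|_|%N; set b := `|_|%N; have ab : (a <= b)%N by rewrite /a /b; lia.
under eq_bigr do rewrite -slot_shareE.
pose F (u : nat) := processing_times S (name j) `&` unit_slot (lo + u%:Z).
(* Windows are closed, so the slot starting at the deadline may be touched, but only in one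
   point. *)
have Fb : mu (F b) = 0%E.
  apply/eqP; rewrite eq_le measure_ge0 andbT -(lebesgue_measure_set1 ((deadline j)%:~R : R)).
  apply: le_measure; rewrite ?inE; [exact: measurable_share | exact: measurable_set1 |].
  move=> t [/(processing_window uI jI) /andP[_ td]]; rewrite /unit_slot /= in_itv /=.
  rewrite (_ : lo + b%:Z = deadline j); last by rewrite /b; lia.
  by move=> /andP[dt _]; apply/eqP; rewrite eq_le td.
case: feasibleS => _ _ _ /(_ j jI) <-.
have <- : (\sum_(a <= u < b.+1) mu (F u) = \sum_(a <= u < b) mu (F u))%E.
  by rewrite big_nat_recr //= Fb adde0.
apply: measure_bigcup_seq_le; first exact: iota_uniq.
- by move=> u _; exact: measurable_share.
- exact: measurable_processing.
move=> t Xt; have /andP[rt td] := processing_window uI jI Xt.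
exists `|Num.floor t - lo|%N => /=.
  rewrite mem_index_iota ltnS.
  have : release j <= Num.floor t by rewrite floor_ge_int.
  have : Num.floor t <= deadline j by rewrite -(@intrKfloor R (deadline j)) le_floor.
  by rewrite /a /b; lia.
split=> //; apply/set_mem; rewrite -floor_unit_slot eq_sym; apply/eqP.
have : release j <= Num.floor t by rewrite floor_ge_int.
by lia.
Qed.
End SlotMeasure.

(** A slot of the window outside [T] gives a job at most one unit, so the slots of [T] must provide
    the rest of [proc j]. All jobs together receive at most [m] units per slot. *)
Lemma feasible_load (R : realType) (I J : seq job) m (S : schedule R) (lo : int) H :
  feasible m I S -> uniq (map name I) -> subseq J I -> {in J, forall j, 0 < proc j}%N ->
  {in J, forall j, lo <= release j /\ deadline j <= lo + H%:Z} ->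
  {in J, forall j,
    lo <= release j /\ release j + (proc j)%:Z <= deadline j <= lo + H%:Z} /\
  load_bound J (fun j => `|release j - lo|%N) (fun j => `|deadline j - lo|%N) proc m H.
Proof.
move=> fS uI JI Jpos Jrange; have JsI := mem_subseq JI.
have rd : {in J, forall j, release j <= deadline j}.
  move=> j jJ; have jI := JsI _ jJ; rewrite -(ler_int R).
  case: (fS) => _ _ _ /(_ j jI) Xp.
  have : (processing_times S (name j) !=set0)%classic.
    apply/set0P/eqP => X0; move: Xp; rewrite X0 measure0 => -[] /eqP.
    by rewrite eq_sym pnatr_eq0 eqn0Ngt Jpos.
  by case=> t /(processing_window fS uI jI) /andP[/le_trans]; apply.
have share j : j \in J -> (proc j)%:R <= \sum_(`|release j - lo|%N <= u < `|deadline j - lo|%N)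
    slot_share S (name j) (lo + u%:Z).
  move=> jJ; apply: (slot_share_proc fS uI (JsI _ jJ)).
  by have [-> _] := Jrange j jJ; rewrite rd.
have fits j : j \in J -> (proc j <= `|deadline j - lo| - `|release j - lo|)%N.
  move=> jJ; rewrite -(ler_nat R); apply: le_trans (share j jJ) _.
  rewrite -[X in _ <= X%:R]muln1 -sum_nat_const_nat natr_sum; apply: ler_sum => u _.
  exact: (slot_share_le1 fS).
split=> [j jJ|T].
  by have [] := Jrange j jJ; have := rd j jJ; have := fits j jJ; lia.
rewrite -(ler_nat R) natr_sum natrM natr_sum mulr_sumr.
apply: (@le_trans _ _ (\sum_(0 <= u < H) \sum_(j <- J) (T u)%:R * slot_share S (name j) (lo + u%:Z))); last first.
  apply: ler_sum => u _; rewrite -mulr_sumr mulrC ler_wpM2r ?ler0n //.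
  rewrite -(big_map name xpredT (fun i => slot_share S i (lo + u%:Z))).
  apply: slot_share_capacity fS _ _ _; apply: subseq_uniq uI; exact: map_subseq.
rewrite exchange_big /= big_seq [leRHS]big_seq; apply: ler_sum => j jJ.
have [lor dH] := Jrange j jJ; have rdj := rd j jJ.
set a := `|release j - lo|%N; set b := `|deadline j - lo|%N.
have ab : (a <= b)%N by rewrite /a /b; lia.
have bH : (b <= H)%N by rewrite /b; lia.
pose g u := slot_share S (name j) (lo + u%:Z).
have gge0 u : 0 <= g u by exact: slot_share_ge0.
apply: (@le_trans _ _ (\sum_(a <= u < b) (T u)%:R * g u)); last first.
  rewrite [leRHS](@big_cat_nat _ _ _ a) //=; last exact: leq_trans bH.
  rewrite [X in _ <= _ + X](@big_cat_nat _ _ _ b) //= addrCA lerDl addr_ge0 //;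
  by apply: sumr_ge0 => u _; rewrite mulr_ge0 ?ler0n ?gge0.
set y := (\sum_(a <= u < b) T u)%N.
case: (leqP y (b - a - proc j)) => [|yl].
  rewrite -subn_eq0 => /eqP ->; apply: sumr_ge0 => u _; rewrite mulr_ge0 ?ler0n //.
rewrite natrB; last exact: ltnW.
rewrite natrB; last exact: fits.
have : \sum_(a <= u < b) g u <= \sum_(a <= u < b) ((T u)%:R * g u + (1 - (T u)%:R)).
  apply: ler_sum => u _; case: (T u); rewrite ?mul1r ?subrr ?addr0 // mul0r add0r subr0.
  exact: (slot_share_le1 fS).
have := share j jJ; rewrite -/a -/b -/g big_split /= sumrB -natr_sum -/y.
rewrite (_ : \sum_(a <= u < b) 1 = (b - a)%:R :> R); last by rewrite sumr_const_nat.
by move=> /le_trans + H1 => /(_ _ H1); lra.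
Qed.

(** * The algorithm and its independence of future jobs *)

(** Feasibility does not force [release j <= deadline j] for a job without work; such jobs are never
    run. *)
Definition active (J : seq job) : seq job := [seq j <- J | 0 < proc j]%N.

Definition team (b : bool) (J : seq job) : seq job :=
  sort lax_ge [seq j <- active J | tight j == b].

Definition capacity (b : bool) (m : nat) (J : seq job) (s : int) : nat :=
  if b then tight_machines m (known (active J) s) else loose_machines m.

Definition crew (b : bool) (m : nat) (J : seq job) (s : int) : seq job :=
  running (capacity b m J) (team b J) s.

Definition first_machine (m : nat) (b : bool) : nat := if b then loose_machines m else 0.

Definition decision (m : nat) (s : int) (J : seq job) (k : nat) : option nat :=
  let b := (loose_machines m <= k)%N in
  onth (map name (crew b m J s)) (k - first_machine m b).

Lemma capacity_bound b m J s : (capacity b m J s <=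
  if b then tight_machines m (size J) else loose_machines m)%N.
Proof.
case: b => //=; rewrite /tight_machines leq_mul2l ltnS leq_mul2l /= ltnS phases_homo ?orbT //.
by rewrite (leq_trans (count_size _ _)) // size_filter count_size.
Qed.

Lemma known_local J s u : u <= s ->
  known (active [seq j <- J | release j <= s]) u = known (active J) u.
Proof.
move=> us; rewrite /known /active !count_filter; apply: eq_count => j /=.
by case: (leP (release j) u) => //= ru; rewrite (le_trans ru us) andbT.
Qed.

(** Filtering commutes with the stable sort, so the team of the released jobs is the released part
    of the team, and [running_local] applies. *)
Lemma crew_local b m J s : crew b m [seq j <- J | release j <= s] s = crew b m J s.
Proof.
rewrite /crew [RHS](@running_local _ (capacity b m [seq j <- J | release j <= s]) _ s) //.
  congr running; rewrite /team (filter_sort lax_ge_total lax_ge_trans); congr sort.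
  rewrite /active -!filter_predI; apply: eq_filter => j /=.
  by case: (release j <= s); rewrite ?andbT ?andbF.
by move=> u us; rewrite /capacity known_local.
Qed.

Lemma decision_local m J s : decision m s [seq j <- J | release j <= s] = decision m s J.
Proof. by apply/funext => k; rewrite /decision crew_local. Qed.

(** * Feasibility of the schedule produced *)

Section Schedule.
Variables (R : realType) (I : seq job) (m : nat).
Hypothesis namesI : distinct_names I.

Lemma uniq_jobs : uniq I. Proof. exact: map_uniq namesI. Qed.

Lemma mem_team b j : (j \in team b I) = [&& j \in I, (0 < proc j)%N & tight j == b].
Proof. by rewrite mem_sort !mem_filter andbC [(0 < _)%N && _]andbC -andbA. Qed.

Lemma uniq_team b : uniq (team b I).
Proof. by rewrite sort_uniq !filter_uniq // uniq_jobs. Qed.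

Lemma crew_sub b s j : j \in crew b m I s -> j \in team b I.
Proof. exact: (mem_subseq (running_subseq _ _ _)). Qed.

Lemma uniq_crew b s : uniq (crew b m I s).
Proof. exact: subseq_uniq (running_subseq _ _ _) (uniq_team b). Qed.

Lemma name_inj : {in I &, injective name}.
Proof.
move=> i j iI jI ij; have /uniqP inj := namesI.
have := inj 0%N (index i I) (index j I); rewrite !inE !size_map !index_mem => /(_ iI jI).
rewrite !(nth_map i) ?index_mem // !nth_index // => /(_ ij) e.
by rewrite -(nth_index i iI) e nth_index.
Qed.

(** Determines the machine of a running job, so that no job runs on two machines. The loose crew
    never exceeds [loose_machines m], which keeps the two blocks of machines apart. *)
Lemma decisionP s k j : j \in I ->
  (decision m s I k == Some (name j)) =
  (j \in crew (tight j) m I s) &&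
    (k == first_machine m (tight j) + index j (crew (tight j) m I s))%N.
Proof.
move=> jI; rewrite /decision; set b := (_ <= k)%N.
have crewI b' i : i \in crew b' m I s -> i \in I /\ tight i = b'.
  by move/crew_sub; rewrite mem_team => /and3P[-> _ /eqP].
apply/eqP/andP => [|[jc /eqP kE]].
  rewrite onth_map; case e : (onth _ _) => [i|] //= [ij].
  have ic : i \in crew b m I s by apply/onthP; exists (k - first_machine m b)%N.
  have [iI ib] := crewI _ _ ic.
  have ei : i = j by exact: name_inj.
  subst i; rewrite ib ic; split=> //.
  have ks : (k - first_machine m b < size (crew b m I s))%N by rewrite -onthTE e.
  rewrite -[X in index X _](onth_nth j _ _ _ e) index_uniq ?uniq_crew //.
  by rewrite subnKC // /first_machine; case: ifP.
have jl : (index j (crew (tight j) m I s) < size (crew (tight j) m I s))%N by rewrite index_mem.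
have eb : b = tight j.
  rewrite /b kE /first_machine; case: (tight j) jl => jl; first by rewrite leq_addr.
  apply/negbTE; rewrite -ltnNge add0n; apply: leq_trans jl _.
  exact: leq_trans (size_running _ _ _) (capacity_bound false _ _ _).
rewrite eb kE addKn onth_map.
have : onth (crew (tight j) m I s) (index j (crew (tight j) m I s)) by rewrite onthTE.
case e : (onth _ _) => [i|] // _ /=; congr Some; congr name.
by rewrite -(onth_nth j _ _ _ e) nth_index.
Qed.

Lemma decision_some s k i : decision m s I k = Some i ->
  exists j, [/\ j \in I, name j = i & j \in crew (tight j) m I s].
Proof.
move=> dk; suff [j [jI ji]] : exists j, j \in I /\ name j = i.
  by exists j; split=> //; move: dk; rewrite -ji => /eqP; rewrite decisionP // => /andP[].
move: dk; rewrite /decision onth_map; case e : (onth _ _) => [j|] //= [<-].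
exists j; split=> //; suff : j \in crew (loose_machines m <= k)%N m I s.
  by move/crew_sub; rewrite mem_team => /and3P[].
by apply/onthP; exists (k - first_machine m (loose_machines m <= k)%N)%N.
Qed.

Lemma decision_bound s k i : decision m s I k = Some i ->
  (k < loose_machines m + tight_machines m (size I))%N.
Proof.
move=> dk; have [j [jI ji _]] := decision_some dk; move/eqP: dk.
rewrite -ji decisionP // => /andP[jc /eqP ->]; move: jc; rewrite -index_mem.
have := leq_trans (size_running _ _ _) (capacity_bound (tight j) m I s).
move=> /(_ (team (tight j) I)); rewrite -/(crew _ _ _ _).
rewrite /first_machine; case: (tight j) => /=; lia.
Qed.

Lemma measurable_floor_preimage (f : int -> bool) : measurable [set t : R | f (Num.floor t)].
Proof.
have -> : [set t : R | f (Num.floor t)] = \bigcup_z (if f z then @unit_slot R z else set0).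
  apply/seteqP; split=> t /=.
    by move=> ft; exists (Num.floor t) => //; rewrite ft; apply/set_mem; rewrite -floor_unit_slot.
  case=> z _; case: ifP => // fz /mem_set; rewrite -floor_unit_slot.
  by move=> /eqP ->.
apply: countable_bigcupT_measurable; first exact: countableP.
by move=> z; case: ifP => // _; exact: measurable_unit_slot.
Qed.

Hypothesis complete : forall b j, j \in team b I ->
  elapsed (fun s => j \in crew b m I s) (release j) (deadline j) = proc j.

Let S : schedule R := fun t => decision m (Num.floor t) I.

Lemma processing_times_crew j : j \in I ->
  processing_times S (name j) = [set t | j \in crew (tight j) m I (Num.floor t)].
Proof.
move=> jI; apply/seteqP; split=> t /=.
  by case=> k /eqP; rewrite decisionP // => /andP[].
move=> jc; eexists; apply/eqP; rewrite decisionP // jc /=; exact: eqxx.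
Qed.

Lemma measure_processing j : j \in I ->
  lebesgue_measure (processing_times S (name j)) = (proc j)%:R%:E.
Proof.
move=> jI; rewrite processing_times_crew //; set b := tight j.
have [jt | jt] := boolP (j \in team b I); last first.
  (* A job of [I] outside its team has no work and is never processed. *)
  have -> : [set t : R | j \in crew b m I (Num.floor t)] = set0.
    by apply/seteqP; split=> t //= /crew_sub; rewrite (negPf jt).
  rewrite measure0; move: jt; rewrite mem_team jI eqxx andbT /= -eqn0Ngt => /eqP -> //.
rewrite -(complete jt) /elapsed -size_filter; set L := [seq _ <- _ | _].
pose F (i : nat) : set R := unit_slot (release j + i%:Z).
have -> : [set t : R | j \in crew b m I (Num.floor t)] = \bigcup_(i in [set` L]) F i.
  apply/seteqP; split=> t /=.
    move=> jc; have /andP[rt td] := running_window jc.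
    have e : release j + `|Num.floor t - release j|%N%:Z = Num.floor t by lia.
    exists `|Num.floor t - release j|%N => /=.
      by rewrite mem_filter e jc mem_iota /=; lia.
    by apply/set_mem; rewrite -floor_unit_slot e.
  case=> i /=; rewrite mem_filter => /andP[jc _] /mem_set; rewrite -floor_unit_slot.
  by move=> /eqP ->.
rewrite measure_bigcup_seq ?filter_uniq ?iota_uniq //.
- rewrite (eq_bigr (fun=> 1%:E)) => [|i _]; last exact: measure_unit_slot.
  by rewrite sumEFin big_const_seq count_predT iter_addr_0.
- by move=> i _; exact: measurable_unit_slot.
- move=> i k _ _ [t [/mem_set + /mem_set]]; rewrite -!floor_unit_slot => /eqP -> /eqP.
  by lia.
Qed.

Lemma decision_feasible :
  feasible (loose_machines m + tight_machines m (size I))%N I S.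
Proof.
split.
- move=> t k i Sk; split; first exact: decision_bound Sk.
  have [j [jI ji jc]] := decision_some Sk; exists j; split=> //.
  have /andP[rt td] := running_window jc.
  rewrite -floor_ge_int rt /= ltW //; apply: lt_le_trans (floorD1_gt t) _.
  by rewrite ler_int lezD1.
- move=> t k l i Sk Sl; have [j [jI ji _]] := decision_some Sk.
  move/eqP: Sk; move/eqP: Sl; rewrite -ji !decisionP //.
  by move=> /andP[_ /eqP ->] /andP[_ /eqP ->].
- move=> k i; rewrite (_ : [set t | _] = [set t : R | decision m (Num.floor t) I k == Some i]).
    exact: (measurable_floor_preimage (fun s => decision m s I k == Some i)).
  by apply/seteqP; split=> t /= /eqP.
- exact: measure_processing.
Qed.
End Schedule.

(** * Competitiveness and the logarithmic ratio *)

Definition urgency_first (R : realType) : semi_online_algorithm R :=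
  fun m t J => decision m (Num.floor t) J.

Lemma time_range (J : seq job) : exists (lo : int) (H : nat),
  {in J, forall j, lo <= release j /\ deadline j <= lo + H%:Z}.
Proof.
elim: J => [|i J [lo [H JH]]]; first by exists 0, 0%N.
exists (lo - `|lo - release i|%N%:Z), (H + `|lo - release i| + `|deadline i - lo|)%N => j.
by rewrite inE => /predU1P[-> | /JH]; lia.
Qed.

Lemma urgency_first_complete (R : realType) (I : seq job) m (S : schedule R) b j :
  distinct_names I -> feasible m I S -> j \in team b I ->
  elapsed (fun s => j \in crew b m I s) (release j) (deadline j) = proc j.
Proof.
move=> nI fS jt; have [lo [H rng]] := time_range (active I).
have uI := uniq_jobs nI; have uA : uniq (active I) by rewrite filter_uniq.
have [w load] := feasible_load fS nI (filter_subseq _ _)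
  (fun j jA => proj1 (andP (etrans (esym (mem_filter _ _ _)) jA))) rng.
have sub b' : {subset team b' I <= active I}.
  by move=> i; rewrite mem_sort mem_filter => /andP[].
have srt : sorted lax_ge (team b I) by exact: sort_sorted lax_ge_total _.
have tb i : i \in team b I -> tight i = b by rewrite mem_team => // /and3P[_ _ /eqP].
case: b jt srt tb => jt srt tb.
- exact: (tight_complete uA w load (uniq_team nI _) srt (sub _) tb jt).
- have loose : {in team false I, forall i, ~~ tight i} by move=> i /tb ->.
  exact: (loose_complete uA w load (uniq_team nI _) srt (sub _) loose jt).
Qed.

(** Here [39 = 6 + 8 * 4 + 1], with [(phases n).+1 = 2 * trunc_log 2 n + 4]. *)
Definition ratio (n : nat) : nat := 16 * trunc_log 2 n + 39.

Lemma ratioE m n : (loose_machines m + tight_machines m n = ratio n * m)%N.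
Proof. rewrite /loose_machines /tight_machines /ratio /phases; lia. Qed.

Lemma urgency_first_competitive (R : realType) :
  competitive (@urgency_first R) (fun n => (ratio n)%:R).
Proof.
move=> I m nI [[S fS] _]; exists (loose_machines m + tight_machines m (size I))%N; split.
  by rewrite ratioE natrM.
(* Release dates are integers, so the jobs released by [t] are those released by the floor of
   [t]. *)
rewrite (_ : run _ m I = fun t => decision m (Num.floor t) I); last first.
  apply/funext => t; rewrite /run /urgency_first -[RHS]decision_local; congr decision.
  by apply: eq_filter => j; rewrite floor_ge_int.
apply: decision_feasible => // b j; exact: urgency_first_complete fS.
Qed.

Lemma ratio_bigO (R : realType) :
  (fun n => (ratio n)%:R : R) =O_\oo (fun n : nat => ln (n%:R : R)).
Proof.
have ln2 : 0 < ln (2 : R) by rewrite ln_gt0 // ltr1n.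
(* [55 = 16 + 39]: for [n >= 2] both [trunc_log 2 n * ln 2] and [ln 2] are at most [ln n]. *)
apply/eqO_exP; exists (55 / ln 2); first by rewrite divr_gt0 // ltr0n.
near=> n; have n2 : (2 <= n)%N by near: n; exact: nbhs_infty_ge.
have n0 : (n%:R : R) \is Num.pos by rewrite posrE ltr0n ltnW.
have lnn : ln (2 : R) <= ln (n%:R : R) by rewrite ler_ln ?ler_nat // posrE ltr0n.
have tl : (trunc_log 2 n)%:R * ln (2 : R) <= ln (n%:R : R).
  rewrite mulr_natl -lnXn ?ltr0n // -natrX ler_ln ?posrE ?ltr0n ?expn_gt0 // ?(ltnW n2) //.
  by rewrite ler_nat trunc_logP // ltnW.
rewrite ger0_norm ?ler0n // ger0_norm; last exact: le_trans (ltW ln2) lnn.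
rewrite mulrAC ler_pdivlMr // /ratio natrD natrM mulrDl -mulrA; lra.
Unshelve. all: by end_near.
Qed.

Theorem theorem20 (R : realType) :
  exists (A : semi_online_algorithm R) (rho : nat -> R),
    competitive A rho /\ rho =O_\oo (fun n : nat => ln (n%:R : R)).
Proof.
by exists (@urgency_first R), (fun n => (ratio n)%:R); split;
  [exact: urgency_first_competitive | exact: ratio_bigO].
Qed.
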